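(* Let $K$ be a field and let $I\subset K[x,y]$ be a convex monomial ideal of height $2$ with an inner corner point. Let $u_1>u_2>\cdots>u_m$ (lexicographic order) be the minimal monomial generators of $I$ and let $J=(u_1,u_m)$. Then $I^{k+1}\ne JI^k$ for all $k\ge1$.
   Context: For a monomial ideal $I\subset K[x,y]$ of height $2$, $G(I)=\{u_1,\ldots,u_m\}$ is its unique minimal set of monomial generators, labeled so that $u_1>\cdots>u_m$ lexicographically (with $x>y$). Writing $u_i=x^{a_i}y^{b_i}$, one has $a_1>\cdots>a_m=0$ and $0=b_1<\cdots<b_m$, so $u_1$ is a pure power of $x$ and $u_m$ is a pure power of $y$. The exponent vector of $u_i$ is $\mathbf c_i=(a_i,b_i)$. For integer vectors, $\mathbf a\le\mathbf b$ means componentwise inequality, and $\mathbf a<\mathbf b$ means $\mathbf a\le\mathbf b$ and $\mathbf a\ne\mathbf b$. The ideal $I$ is convex if $2\mathbf c_i\le\mathbf c_{i-1}+\mathbf c_{i+1}$ for $i=2,\ldots,m-1$. An inner corner point of a convex ideal $I$ is a vector $\mathbf c_i$ with $2\le i\le m-1$ and $2\mathbf c_i<\mathbf c_{i-1}+\mathbf c_{i+1}$. *)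

(* Defs.v *)
From HB Require Import structures.
From mathcomp Require Import all_boot all_order all_algebra.
From mathcomp Require Import mpoly.
From mathcomp Require Import boolp classical_sets.

Set Implicit Arguments.
Unset Strict Implicit.
Unset Printing Implicit Defensive.

Import Order.TTheory GRing.Theory.
Local Open Scope classical_set_scope.
Local Open Scope ring_scope.

Section Ideals.
Variable R : comNzRingType.
Implicit Types (A I J P : set R) (h k n : nat).

(* Unlike [idealr_closed], this does not require 1 to be outside I. *)
Definition is_ideal I : Prop :=
  [/\ I 0, forall f g, I f -> I g -> I (f + g) & forall f g, I g -> I (f * g)].

Definition ideal_gen A : set R := smallest is_ideal A.

Definition ideal_mul I J : set R := ideal_gen [set f * g | f in I & g in J].

Definition ideal_exp I k : set R := iter k (ideal_mul I) setT.

(* [idealr_closed] includes properness. *)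
Definition is_prime_ideal P : Prop :=
  idealr_closed (mem P) /\ prime_idealr_closed (mem P).

Definition prime_chain P n : Prop :=
  exists p : nat -> set R,
    [/\ forall i, (i <= n)%N -> is_prime_ideal (p i),
        forall i, (i < n)%N -> p i `<` p i.+1
      & p n = P].

Definition prime_height P n : Prop :=
  prime_chain P n /\ forall m, prime_chain P m -> (m <= n)%N.

(* The minimum of the heights of the primes containing I; primes of infinite
   height impose no constraint. *)
Definition ideal_height I h : Prop :=
  (exists P, [/\ is_prime_ideal P, I `<=` P & prime_height P h]) /\
  (forall P n, is_prime_ideal P -> I `<=` P -> prime_height P n -> (h <= n)%N).

End Ideals.

(* The exponent of x is the component of index 0, that of y the component of
   index 1. *)
Section Monomials.
Variable K : fieldType.
Implicit Types (A : set 'X_{1..2}) (I : set {mpoly K[2]}).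

Definition monomial_gen A : set {mpoly K[2]} :=
  ideal_gen [set 'X_[K, a] | a in A].

Definition is_monomial_ideal I : Prop := exists A, I = monomial_gen A.

Definition lex_gt (a b : 'X_{1..2}) : bool :=
  ((multinom_val b : 2.-tuplelexi nat) < multinom_val a)%O.

(* c lists the exponent vectors of G(I) in decreasing lexicographic order. *)
Definition minimal_generators I (c : seq 'X_{1..2}) : Prop :=
  [/\ sorted lex_gt c, monomial_gen [set` c] = I
    & forall A, A `<=` [set` c] -> monomial_gen A = I -> A = [set` c]].

End Monomials.

(* Indices are 0-based: the i-th vector of the usual 1-based numbering is
   [nth 0%MM c i.-1]. *)
Section Convexity.
Implicit Types (a b : 'X_{1..2}) (c : seq 'X_{1..2}) (i : nat).

(* Strict componentwise order; [<] on multinomials is a degree order. *)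
Definition mnm_ltc a b : bool := (a <= b)%MM && (a != b).

Definition convex_exponents c : Prop :=
  forall i, (0 < i)%N -> (i.+1 < size c)%N ->
    (nth 0%MM c i *+ 2 <= nth 0%MM c i.-1 + nth 0%MM c i.+1)%MM.

Definition inner_corner c a : Prop :=
  exists i, [/\ (0 < i)%N, (i.+1 < size c)%N, a = nth 0%MM c i
    & mnm_ltc (a *+ 2)%MM (nth 0%MM c i.-1 + nth 0%MM c i.+1)%MM].

End Convexity.

(* Main.v *)
Require Import Defs.
From HB Require Import structures.
From mathcomp Require Import all_boot all_order all_algebra.
From mathcomp Require Import mpoly.
From mathcomp Require Import boolp classical_sets.
From mathcomp Require Import zify.

Set Implicit Arguments.
Unset Strict Implicit.
Unset Printing Implicit Defensive.

Local Open Scope classical_set_scope.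
Local Open Scope ring_scope.

(** An inner corner [c_i] is a vertex of the Newton polygon of [I]: some linear
    weight [w] with nonnegative coefficients is smaller at [c_i] than at every
    other generator. Give a polynomial as order the least weight of its
    monomials; orders add under multiplication. With [W = w(c_i)], every
    element of [I^k] has order at least [k * W], and every element of [J] has
    order at least [W + 1], because the two generators of [J] are not [c_i].
    So [J I^k] has order at least [(k + 1) * W + 1], while [u_i^(k+1)] belongs
    to [I^(k+1)] and has weight exactly [(k + 1) * W].

    The weight is the inner normal of the chord from [c_(i-1)] to [c_(i+1)].
    Since its coefficients are nonnegative, convexity of [I] makes
    [j |-> w(c_j)] a convex sequence, and the strictness at the corner makes
    [i] a strict local minimum of it; a strict local minimum of a convex
    sequence is its only global minimum ([convex_seq_local_min]). *)

(** * Generated ideals *)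

Section IdealGeneration.
Variable R : comNzRingType.
Implicit Types (A I J V : set R) (k : nat).

Lemma is_ideal_gen A : is_ideal (ideal_gen A).
Proof.
split=> [B [[B0 _ _] _] //|f g fA gA B [Bi AB]|f g gA B [Bi AB]].
- by case: (Bi) => _ BD _; apply: BD; [apply: fA|apply: gA].
- by case: (Bi) => _ _ BM; apply: BM; apply: gA.
Qed.

Lemma ideal_gen_min A V : is_ideal V -> A `<=` V -> ideal_gen A `<=` V.
Proof. exact: smallest_sub. Qed.

Lemma sub_ideal_gen A : A `<=` ideal_gen A.
Proof. exact: sub_gen_smallest. Qed.

Lemma ideal_exp_pow I f k : I f -> ideal_exp I k (f ^+ k).
Proof.
move=> If; elim: k => [//|k IHk].
by apply: sub_ideal_gen; exists f => //; exists (f ^+ k); rewrite ?GRing.exprS.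
Qed.

End IdealGeneration.

(** * Minimal systems of monomial generators *)

Section MinimalGenerators.
Variable K : fieldType.
Implicit Types (I : set {mpoly K[2]}) (a b : 'X_{1..2}) (c : seq 'X_{1..2}).

Lemma lex_gt_le0 a b : lex_gt a b -> (b ord0 <= a ord0)%N.
Proof.
rewrite /lex_gt !mnm_tnth.
case: a b => [[[|a0 [|a1 [|? ?]]] //= sa]] [[[|b0 [|b1 [|? ?]]] //= sb]].
move/Order.POrderTheory.ltW; rewrite /Order.le /= /Order.le /=.
by case/andP.
Qed.

(** A generator lying above another one could be dropped. *)
Lemma minimal_generators_antichain I c a b :
  minimal_generators I c -> a \in c -> b \in c -> (a <= b)%MM -> a = b.
Proof.
move=> [_ cI cmin] ac bc leab; apply: contrapT => neab.
suff: [set` c] `\ b = [set` c] by move/seteqP => [_ /(_ b bc)] /= [].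
apply: cmin; first by move=> x [].
rewrite -cI; apply/seteqP; split.
  apply: ideal_gen_min; first exact: is_ideal_gen.
  by move=> _ [x [xc _] <-]; apply: sub_ideal_gen; exists x.
apply: ideal_gen_min; first exact: is_ideal_gen.
move=> _ [x xc <-]; have [->|nexb] := eqVneq x b; last first.
  by apply: sub_ideal_gen; exists x => //; split=> //; apply/eqP.
have [_ _ genM] := is_ideal_gen [set 'X_[K, y] | y in [set` c] `\ b].
have Xa : monomial_gen ([set` c] `\ b) 'X_[K, a].
  by apply: sub_ideal_gen; exists a.
by have := genM 'X_[K, b - a] _ Xa; rewrite -mpolyXD submK.
Qed.

(** Lexicographic order makes the abscissas weakly decrease along [c];
    incomparability of neighbours then turns this into a strict decrease
    together with a strict increase of the ordinates. *)
Lemma minimal_generators_step I c i :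
  minimal_generators I c -> (i.+1 < size c)%N ->
  (nth 0%MM c i.+1 ord0 < nth 0%MM c i ord0)%N /\
  (nth 0%MM c i ord_max < nth 0%MM c i.+1 ord_max)%N.
Proof.
move=> cgen lti; have [csort _ _] := cgen.
have lexc := sortedP 0%MM csort i lti.
have ac : nth 0%MM c i \in c by rewrite mem_nth // ltnW.
have bc : nth 0%MM c i.+1 \in c by rewrite mem_nth.
have le0 := lex_gt_le0 lexc.
have neq : nth 0%MM c i <> nth 0%MM c i.+1.
  by move=> e; move: lexc; rewrite e /lex_gt Order.POrderTheory.ltxx.
have ord2 (j : 'I_2) : j = ord0 \/ j = ord_max.
  by case: j => [[|[|//]] p]; [left|right]; apply: val_inj.
have lt1 : (nth 0%MM c i ord_max < nth 0%MM c i.+1 ord_max)%N.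
  rewrite ltnNge; apply/negP => le1; apply: neq; symmetry.
  apply: (minimal_generators_antichain cgen) => //.
  by apply/mnm_lepP => j; case: (ord2 j) => ->.
split=> //; rewrite ltnNge; apply/negP => ge0; apply: neq.
apply: (minimal_generators_antichain cgen) => //.
by apply/mnm_lepP => j; case: (ord2 j) => ->; last exact: ltnW.
Qed.

End MinimalGenerators.

(** * The weight order of a polynomial *)

Section WeightOrder.
Variables (K : fieldType) (w0 w1 : nat).
Implicit Types (a b m : 'X_{1..2}) (p q : {mpoly K[2]}) (d e k : nat).

Definition weight m : nat := (w0 * m ord0 + w1 * m ord_max)%N.

Lemma weightD a b : weight (a + b)%MM = (weight a + weight b)%N.
Proof. by rewrite /weight !mnmDE; lia. Qed.

Lemma weightMn a k : weight (a *+ k)%MM = (k * weight a)%N.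
Proof. by rewrite /weight !mulmnE; lia. Qed.

Lemma weight_le a b : (a <= b)%MM -> (weight a <= weight b)%N.
Proof. by move/mnm_lepP => ab; rewrite leq_add // leq_mul. Qed.

Definition weight_ge d : set {mpoly K[2]} :=
  [set p | forall m, m \in msupp p -> (d <= weight m)%N].

Lemma weight_geX d a : weight_ge d 'X_[K, a] <-> (d <= weight a)%N.
Proof.
split=> [->//|da m]; first by rewrite msuppX mem_head.
by rewrite msuppX inE => /eqP->.
Qed.

Lemma weight_geM d e p q :
  weight_ge d p -> weight_ge e q -> weight_ge (d + e) (p * q).
Proof.
move=> dp eq_ m /msuppM_le /allpairsP [[a b] /= [ap bq ->]].
by rewrite weightD leq_add ?dp ?eq_.
Qed.

Lemma weight_ge_ideal d : is_ideal (weight_ge d).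
Proof.
split=> [m|p q dp dq m /msuppD_le|p q dq]; first by rewrite msupp0.
  by rewrite mem_cat => /orP [/dp|/dq].
by rewrite -[d]add0n; exact: weight_geM.
Qed.

Lemma ideal_mul_weight_ge d e (I J : set {mpoly K[2]}) :
  I `<=` weight_ge d -> J `<=` weight_ge e ->
  ideal_mul I J `<=` weight_ge (d + e).
Proof.
move=> Id Je; apply: ideal_gen_min; first exact: weight_ge_ideal.
by move=> _ [p Ip [q Jq <-]]; apply: weight_geM; [apply: Id|apply: Je].
Qed.

Lemma ideal_exp_weight_ge d (I : set {mpoly K[2]}) k :
  I `<=` weight_ge d -> ideal_exp I k `<=` weight_ge (k * d).
Proof.
move=> Id; elim: k => [p _ m //|k IHk].
by rewrite mulSn; apply: ideal_mul_weight_ge.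
Qed.

End WeightOrder.

(** * The weight singling out an inner corner *)

(** Convexity propagates the two strict inequalities around [i.+1]:
    the increments stay positive to its right and negative to its left. *)
Lemma convex_seq_local_min (F : nat -> nat) n i :
  (forall j, (j.+2 < n)%N -> ((F j.+1).*2 <= F j + F j.+2)%N) ->
  (i.+2 < n)%N -> (F i.+1 < F i)%N -> (F i.+1 < F i.+2)%N ->
  forall j, (j < n)%N -> j <> i.+1 -> (F i.+1 < F j)%N.
Proof.
move=> cvx ltin decr incr.
have right d : (i.+2 + d < n)%N ->
    (F i.+1 < F (i.+2 + d) /\ F (i.+1 + d) < F (i.+2 + d))%N.
  elim: d => [|d IHd] lt; first by rewrite !addn0.
  have := cvx (i.+1 + d)%N; rewrite !addnS !addSn in lt IHd *; lia.
have left d : (d <= i)%N ->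
    (F i.+1 < F (i - d)%N /\ F (i - d).+1 < F (i - d)%N)%N.
  elim: d => [|d IHd] lt; first by rewrite subn0.
  have := cvx (i - d.+1)%N; have -> : (i - d.+1).+1 = (i - d)%N by lia.
  by have := IHd (ltnW lt); lia.
move=> j ltj nej; have [lei|gti] := leqP j i.
  by have [] := left (i - j)%N (leq_subr _ _); rewrite subKn.
by have [] := right (j - i.+2)%N; rewrite subnKC; lia.
Qed.

(** Both inequalities say that, with [p >= q] the two successive drops in
    abscissa and [r <= s] the two successive rises in ordinate,
    [q * r < p * s], that is, [r / p < s / q]: the chain of the three points
    really bends at the middle one. *)
Lemma corner_normal (a0 a1 a2 b0 b1 b2 : nat) :
  (a2 < a1)%N -> (a1 < a0)%N -> (b0 < b1)%N -> (b1 < b2)%N ->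
  (a1 * 2 <= a0 + a2)%N -> (b1 * 2 <= b0 + b2)%N ->
  (a1 * 2 < a0 + a2 \/ b1 * 2 < b0 + b2)%N ->
  ((b2 - b0) * a1 + (a0 - a2) * b1 < (b2 - b0) * a0 + (a0 - a2) * b0)%N /\
  ((b2 - b0) * a1 + (a0 - a2) * b1 < (b2 - b0) * a2 + (a0 - a2) * b2)%N.
Proof.
move=> lta21 lta10 ltb01 ltb12 lea leb strict.
pose p := (a0 - a1)%N; pose q := (a1 - a2)%N.
pose r := (b1 - b0)%N; pose s := (b2 - b1)%N.
have slope : (q * r < p * s)%N by rewrite /p /q /r /s; nia.
have ea1 : a1 = (a2 + q)%N by rewrite /q; lia.
have ea0 : a0 = (a2 + q + p)%N by rewrite /p /q; lia.
have eb1 : b1 = (b0 + r)%N by rewrite /r; lia.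
have eb2 : b2 = (b0 + r + s)%N by rewrite /r /s; lia.
have -> : (b2 - b0 = r + s)%N by lia.
have -> : (a0 - a2 = q + p)%N by lia.
clearbody p q r s; subst; split; nia.
Qed.

Lemma convex_corner_weight (K : fieldType) (I : set {mpoly K[2]})
    (c : seq 'X_{1..2}) (i : nat) :
  minimal_generators I c -> convex_exponents c -> (i.+2 < size c)%N ->
  mnm_ltc (nth 0%MM c i.+1 *+ 2)%MM (nth 0%MM c i + nth 0%MM c i.+2)%MM ->
  exists w0 w1, forall j, (j < size c)%N -> j <> i.+1 ->
    (weight w0 w1 (nth 0%MM c i.+1) < weight w0 w1 (nth 0%MM c j))%N.
Proof.
move=> cgen cvx lti /andP [lec nec].
set A := fun j => nth 0%MM c j ord0; set B := fun j => nth 0%MM c j ord_max.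
have [a1 b1] := minimal_generators_step cgen (ltnW lti).
have [a2 b2] := minimal_generators_step cgen lti.
have /mnm_lepP leP := lec.
have := leP ord0; have := leP ord_max; rewrite !mulmnE !mnmDE => leb lea.
have strict : (A i.+1 * 2 < A i + A i.+2 \/ B i.+1 * 2 < B i + B i.+2)%N.
  have [?|ge0] := ltnP (A i.+1 * 2) (A i + A i.+2); first by left.
  right; rewrite ltnNge; apply/negP => ge1; case/eqP: nec.
  apply/mnmP => j; apply/eqP; rewrite mulmnE mnmDE eqn_leq.
  have /orP : (j == ord0) || (j == ord_max) by case: j => [[|[|//]] p].
  by case=> /eqP ->; apply/andP; split.
(* Components of the inner normal of the chord from [c_i] to [c_(i+2)]. *)
pose w0 := (B i.+2 - B i)%N; pose w1 := (A i - A i.+2)%N.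
exists w0, w1.
apply: (convex_seq_local_min (F := fun j => weight w0 w1 (nth 0%MM c j)))
  => // [j ltj||].
- rewrite -mul2n -weightMn -weightD; apply: weight_le.
  exact: (cvx j.+1).
- by have [] := corner_normal a2 a1 b1 b2 lea leb strict.
- by have [] := corner_normal a2 a1 b1 b2 lea leb strict.
Qed.

Theorem proposition2p9 (K : fieldType) (I J : set {mpoly K[2]})
    (c : seq 'X_{1..2}) (I_monomial : is_monomial_ideal I)
    (I_height : ideal_height I 2) (c_gens : minimal_generators I c)
    (I_convex : convex_exponents c) (I_corner : exists a, inner_corner c a)
    (J_def : J = ideal_gen [set 'X_[K, head 0%MM c]; 'X_[K, last 0%MM c]]) :
  forall k : nat, (1 <= k)%N ->
    ideal_exp I k.+1 <> ideal_mul J (ideal_exp I k).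
Proof.
move=> k _ eqIJ; case: I_corner => a [[|i] [//]] _ lti {a}-> corner.
have [w0 [w1 wmin]] := convex_corner_weight c_gens I_convex lti corner.
set u := nth 0%MM c i.+1 in wmin corner; set W := weight w0 w1 u in wmin.
have [_ genI _] := c_gens.
have Iu : I 'X_[K, u].
  by rewrite -genI; apply: sub_ideal_gen; exists u => //; apply/mem_nth/ltnW.
have I_ge : I `<=` weight_ge w0 w1 W.
  rewrite -genI; apply: ideal_gen_min; first exact: weight_ge_ideal.
  move=> _ [a ac <-]; apply/weight_geX.
  rewrite -(nth_index 0%MM ac); have [->//|/eqP ne] := eqVneq (index a c) i.+1.
  by apply/ltnW/wmin => //; rewrite index_mem.
have J_ge : J `<=` weight_ge w0 w1 W.+1.
  rewrite J_def; apply: ideal_gen_min; first exact: weight_ge_ideal.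
  have c_gt0 : (0 < size c)%N by apply: leq_ltn_trans lti.
  move=> _ [->|->]; apply/weight_geX.
    by rewrite -nth0; apply: wmin.
  by rewrite -nth_last; apply: wmin; lia.
have := ideal_exp_pow k.+1 Iu; rewrite eqIJ.
move/(ideal_mul_weight_ge J_ge (ideal_exp_weight_ge I_ge (k := k))).
by rewrite mpolyXn => /weight_geX; rewrite weightMn mulSn ltnn.
Qed.
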